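(* Let $(\mathbb G,\Delta)$ be a compact quantum group and let $(C^\infty_{\mathcal D},L^2(\mathbb G),\mathcal D)$ be a summable spectral triple. Let $A:C^\infty_{\mathcal D}\to\mathcal S'(\mathbb G)$ be a pseudo-differential operator, i.e. a linear continuous operator. Then there is a distribution $K_A\in\mathcal S'(\mathbb G)\widehat\otimes\mathcal S'(\mathbb G)$ such that $$(A\varphi)(\psi)=K_A(\varphi\otimes\psi)\qquad\text{for all }\varphi,\psi\in C^\infty_{\mathcal D}.$$
   Context: A compact quantum group is a pair $(\mathbb G,\Delta)$ with $\mathbb G$ a unital $C^*$-algebra and $\Delta:\mathbb G\to\mathbb G\otimes\mathbb G$ (minimal tensor product) a unital $*$-homomorphism that is coassociative and such that $\overline{\mathrm{span}}\,(1\otimes\mathbb G)\Delta(\mathbb G)=\overline{\mathrm{span}}\,(\mathbb G\otimes 1)\Delta(\mathbb G)=\mathbb G\otimes\mathbb G$. $\widehat{\mathbb G}$ is the set of irreducible finite-dimensional unitary representations $\pi=[\pi_{ij}]_{i,j=1}^{n_\pi}$ up to equivalence, $\mathbb C[\mathbb G]$ the span of all matrix elements $\pi_{ij}$, $h$ the Haar state, $L^2(\mathbb G)$ the GNS Hilbert space of $h$. $\mathcal D$ is the closed operator on $L^2(\mathbb G)$ extending $\mathcal D\pi_{ij}=\lambda_\pi\pi_{ij}$, with $\lambda_\pi$ nonzero real numbers. $C^\infty_{\mathcal D}=\bigcap_{\alpha\ge0}\mathrm{Dom}(|\mathcal D|^\alpha)$ with the Fréchet topology of the seminorms $\|\varphi\|_\alpha=\||\mathcal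 D|^\alpha\varphi\|_{L^2(\mathbb G)}$, $\alpha\ge0$. Being a (bare) spectral triple means that $C^\infty_{\mathcal D}$ is a $*$-algebra acting on $L^2(\mathbb G)$ by bounded left multiplication operators, $\mathcal D$ has discrete spectrum, and $[|\mathcal D|,a]$ is bounded for every $a\in C^\infty_{\mathcal D}$; summable means that for some $\beta>0$ one has $\sum_k|\lambda_k|^{-\beta}<\infty$, the sum being over the eigenvalues of $\mathcal D$ counted with multiplicity. $\mathcal S'(\mathbb G)=[C^\infty_{\mathcal D}]^*$ is the space of continuous linear functionals on $C^\infty_{\mathcal D}$, with the strong dual topology. $C^\infty_{\mathcal D}\widehat\otimes C^\infty_{\mathcal D}$ is the completed topological tensor product (the projective and injective ones coincide by nuclearity), and by definition $\mathcal S'(\mathbb G)\widehat\otimes\mathcal S'(\mathbb G):=[C^\infty_{\mathcal D}\widehat\otimes C^\infty_{\mathcal D}]^*$ is the space of continuous linear functionals on it. *)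

(* Defs.v *)
From HB Require Import structures.
From mathcomp Require Import all_boot all_order all_algebra.
From mathcomp Require Import complex.
From mathcomp Require Import all_classical all_reals all_analysis.
From mathcomp Require Import lra ring.

Set Implicit Arguments.
Unset Strict Implicit.
Unset Printing Implicit Defensive.

Import Order.TTheory GRing.Theory Num.Theory.
Import numFieldNormedType.Exports.

Local Open Scope classical_set_scope.
Local Open Scope ring_scope.
Local Open Scope complex_scope.
Local Open Scope convex_scope.

Section LinearHull.
Context {K : numFieldType} {V : lmodType K}.

Definition lin_hull (S : set V) : set V :=
  [set v | exists n (c : 'I_n -> K) (s : 'I_n -> V),
    (forall i, S (s i)) /\ v = \sum_i c i *: s i].

Definition lin_indep n (x : 'I_n -> V) : Prop :=
  forall c : 'I_n -> K, \sum_i c i *: x i = 0 -> forall i, c i = 0.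

Lemma lin_hull0 S : lin_hull S 0.
Proof.
exists 0%N, (fun=> 0), (fun=> 0); split; first by case.
by rewrite big_ord0.
Qed.

Lemma lin_hullD S u v : lin_hull S u -> lin_hull S v -> lin_hull S (u + v).
Proof.
move=> [n [c [s [sS ->]]]] [m [d [t [tT ->]]]].
exists (n + m)%N, (fun i => match fintype.split i with inl j => c j | inr j => d j end),
  (fun i => match fintype.split i with inl j => s j | inr j => t j end); split.
  by move=> i; case: (fintype.split i).
rewrite big_split_ord/=; congr (_ + _); apply: eq_bigr => i _.
- by have -> : fintype.split (lshift m i) = inl i by exact: (unsplitK (inl i)).
- by have -> : fintype.split (rshift n i) = inr i by exact: (unsplitK (inr i)).
Qed.

Lemma lin_hullZ S a u : lin_hull S u -> lin_hull S (a *: u).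
Proof.
move=> [n [c [s [sS ->]]]]; exists n, (fun i => a * c i), s; split=> //.
by rewrite scaler_sumr; apply: eq_bigr => i _; rewrite scalerA.
Qed.

End LinearHull.

(* Inner products are linear in the first variable. *)
HB.mixin Record isHilbert (R : realType) H & CompleteNormedModule R[i] H := {
  dot : H -> H -> R[i];
  dot_linear : forall (a : R[i]) (x y z : H),
    dot (a *: x + y) z = a * dot x z + dot y z;
  dot_conj : forall x y : H, dot y x = Num.conj (dot x y);
  dot_norm : forall x : H, dot x x = `|x| ^+ 2;
}.

#[short(type="hilbertType")]
HB.structure Definition Hilbert (R : realType) :=
  {H of isHilbert R H & CompleteNormedModule R[i] H}.

(* Unital C*-algebras.  The product is a field of the mixin because the
   library has no join of its ring structures and its normed modules (both
   are already joined, too high, by [numDomainType]). *)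
HB.mixin Record isCStar (R : realType) A & CompleteNormedModule R[i] A := {
  cmul : A -> A -> A;
  cone : A;
  star : A -> A;
  cmul_linearl : forall (c : R[i]) (a b x : A),
    cmul (c *: a + b) x = c *: cmul a x + cmul b x;
  cmul_linearr : forall (c : R[i]) (a b x : A),
    cmul x (c *: a + b) = c *: cmul x a + cmul x b;
  cmulA : associative cmul;
  cmul1l : left_id cone cmul;
  cmul1r : right_id cone cmul;
  star_antilinear : forall (c : R[i]) (a b : A),
    star (c *: a + b) = Num.conj c *: star a + star b;
  starM : forall a b : A, star (cmul a b) = cmul (star b) (star a);
  starK : involutive star;
  normM_le : forall a b : A, `|cmul a b| <= `|a| * `|b|;
  normC_star : forall a : A, `|cmul (star a) a| = `|a| ^+ 2;
}.

#[short(type="cstarType")]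
HB.structure Definition CStar (R : realType) :=
  {A of isCStar R A & CompleteNormedModule R[i] A}.

Notation "a ** b" := (cmul a b) (at level 40, left associativity).

Section ClosureLinear.
Context {K : numFieldType} {V : tvsType K}.
Implicit Types L : set V.

Lemma closure_addr L : (forall u v, L u -> L v -> L (u + v)) ->
  forall u v, closure L u -> closure L v -> closure L (u + v).
Proof.
move=> LD u v Lu Lv B /(@add_continuous V (u, v)) [[U W]/= [Uu Wv] UWB].
have [u' [Lu' Uu']] := Lu _ Uu; have [v' [Lv' Wv']] := Lv _ Wv.
by exists (u' + v'); split; [exact: LD|exact: (UWB (u', v'))].
Qed.

Lemma closure_scaler L (a : K) : (forall u, L u -> L (a *: u)) ->
  forall u, closure L u -> closure L (a *: u).
Proof.
move=> LZ u Lu B /(@scale_continuous K V (a, u)) [[U W]/= [Ua Wu] UWB].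
have [u' [Lu' Wu']] := Lu _ Wu.
exists (a *: u'); split; first exact: LZ.
by apply: (UWB (a, u')); split=> //=; exact: nbhs_singleton.
Qed.

End ClosureLinear.

Section Dual.
Context {K : numFieldType} {E : tvsType K}.

Definition dual_pred : {pred E -> K^o} :=
  fun f => `[< linear f /\ continuous f >].

Lemma dual_submod : submod_closed dual_pred.
Proof.
split=> [|a f g]; rewrite ?unfold_in.
  apply/asboolP; split; first by move=> c u v /=; rewrite scaler0 addr0.
  by move=> x; exact: cvg_cst.
move=> /asboolP[lf cf] /asboolP[lg cg]; apply/asboolP; split.
  move=> c u v; rewrite /GRing.add/= /GRing.scale/= lf lg.
  by rewrite /GRing.scale/= !mulrDr mulrCA addrACA.
by move=> x; apply: cvgD; [apply: cvgZr; exact: cf|exact: cg].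
Qed.

HB.instance Definition _ := GRing.isSubmodClosed.Build K (E -> K^o)
  dual_pred dual_submod.

Record dual := Dual { dual_fun :> E -> K^o; _ : dual_fun \in dual_pred }.

HB.instance Definition _ := [isSub for dual_fun].
HB.instance Definition _ := [Choice of dual by <:].
HB.instance Definition _ := [SubChoice_isSubLmodule of dual by <:].

Definition vN_bounded (B : set E) : Prop :=
  forall U, nbhs (0 : E) U -> exists2 r : K, 0 < r &
    forall z : K, r <= `|z| -> B `<=` *:%R z @` U.

(* The strong topology on the dual: uniform convergence on bounded sets. *)
HB.instance Definition _ := Topological.copy dual
  (initial_topology
    (fun f : dual => (dual_fun f : {family vN_bounded, E -> K^o}))).

End Dual.
Arguments dual {K} E.

Lemma ge0_complexE (R : rcfType) (z : R[i]) :
  0 <= z -> exists2 n : R, 0 <= n & z = n%:C.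
Proof.
move=> z0; have zE := RRe_real (ger0_real z0).
by exists (complex.Re z); rewrite // -lecR zE.
Qed.

Section Operators.
Context {R : realType} {H : hilbertType R}.

(* Unbounded operators are given by their graphs. *)
Definition resolvent (T : set (H * H)) : set R[i]^o :=
  [set z | (forall y, exists! x, T (x, y + z *: x)) /\
    exists C : R, forall x y, T (x, y + z *: x) -> `|x| <= C%:C * `|y|].

Definition spectrum (T : set (H * H)) : set R[i]^o := ~` resolvent T.

Definition discrete_spectrum (T : set (H * H)) : Prop :=
  forall z, spectrum T z ->
    [/\ isolated (spectrum T) z,
        exists2 x, x != 0 & T (x, z *: x) &
        exists n (b : 'I_n -> H), forall x, T (x, z *: x) -> lin_hull (range b) x].

(* The closure of the operator e_j |-> (f j) e_j defined on the linear hull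
   of the family [e]. *)
Definition diag_op (J : Type) (e : J -> H) (f : J -> R) : set (H * H) :=
  closure (lin_hull [set p | exists j, p = (e j, (f j)%:C *: e j)]).

End Operators.

Section Smooth.
Context {R : realType} {H : hilbertType R} {J : Type}.
Variables (e : J -> H) (mu : J -> R).

(* Functional calculus of D = diag_op e mu: |D|^a acts on the eigenspace
   of D for mu_j as multiplication by |mu_j|^a. *)
Definition abs_pow (a : R) : set (H * H) :=
  diag_op e (fun j => `|mu j| `^ a).

Definition smooth_set : set H :=
  [set x | forall a, 0 <= a -> exists y, abs_pow a (x, y)].

Definition smooth_pred : {pred H} := fun x => `[< smooth_set x >].

Lemma abs_pow0 a : abs_pow a (0, 0).
Proof. by apply: subset_closure; exact: lin_hull0. Qed.

Lemma abs_powD a x y x' y' : abs_pow a (x, y) -> abs_pow a (x', y') ->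
  abs_pow a (x + x', y + y').
Proof. by apply: closure_addr => u v; exact: lin_hullD. Qed.

Lemma abs_powZ a (c : R[i]) x y : abs_pow a (x, y) ->
  abs_pow a (c *: x, c *: y).
Proof. by move/(@closure_scaler _ _ _ c); apply => u; exact: lin_hullZ. Qed.

Lemma smooth_submod : submod_closed smooth_pred.
Proof.
split=> [|c x y]; rewrite ?unfold_in.
  by apply/asboolP => a _; exists 0; exact: abs_pow0.
move=> /asboolP sx /asboolP sy; apply/asboolP => a a0.
have [x' xx'] := sx a a0; have [y' yy'] := sy a a0.
by exists (c *: x' + y'); apply: abs_powD => //; exact: abs_powZ.
Qed.

HB.instance Definition _ := GRing.isSubmodClosed.Build R[i] H
  smooth_pred smooth_submod.

Record smooth := Smooth { smooth_val :> H; _ : smooth_val \in smooth_pred }.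

HB.instance Definition _ := [isSub for smooth_val].
HB.instance Definition _ := [Choice of smooth by <:].
HB.instance Definition _ := [SubChoice_isSubLmodule of smooth by <:].

(* The open ball of radius r of the seminorm x |-> || |D|^a x ||. *)
Definition semiball (a r : R) : set smooth :=
  [set x | exists2 y, abs_pow a (smooth_val x, y) & `|y| < r%:C].

Definition smooth_ball (s : seq R) (r : R) (x : smooth) : set smooth :=
  [set y | forall a, a \in s -> semiball a r (y - x)].

Definition smooth_nbhs (x : smooth) : set_system smooth :=
  filter_from [set p : seq R * R | (forall a, a \in p.1 -> 0 <= a) /\ 0 < p.2]
    (fun p => smooth_ball p.1 p.2 x).

HB.instance Definition _ := hasNbhs.Build smooth smooth_nbhs.

Lemma semiball0 a r : 0 < r -> semiball a r 0.
Proof. by move=> r0; exists 0; [exact: abs_pow0|rewrite normr0 ltcR]. Qed.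

Lemma semiballD a r r' x y : semiball a r x -> semiball a r' y ->
  semiball a (r + r') (x + y).
Proof.
move=> [x' xx' xr] [y' yy' yr]; exists (x' + y'); first exact: abs_powD.
by rewrite rmorphD (le_lt_trans (ler_normD _ _))// ltrD.
Qed.

Lemma semiballZ a r (c : R[i]) k x : 0 < r -> `|c| <= k%:C -> semiball a r x ->
  0 < k -> semiball a (k * r) (c *: x).
Proof.
move=> r0 ck [y xy yr] k0; exists (c *: y); first exact: abs_powZ.
rewrite normrZ rmorphM (@le_lt_trans _ _ (k%:C * `|y|))//.
  by rewrite ler_wpM2r.
by rewrite ltr_pM2l// ltcR.
Qed.

Lemma le_semiball a r r' x : r <= r' -> semiball a r x -> semiball a r' x.
Proof.
by move=> rr' [y xy yr]; exists y; rewrite // (lt_le_trans yr)// lecR.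
Qed.

Lemma semiball_lt a r x : semiball a r x -> 0 < r ->
  exists2 d, 0 < d < r & semiball a (r - d) x.
Proof.
move=> [y xy yr] r0.
have [n n0 yE] := ge0_complexE (normr_ge0 y); rewrite yE ltcR in yr.
exists ((r - n) / 2); first by apply/andP; split; lra.
by exists y => //; rewrite yE ltcR; lra.
Qed.

Lemma semiball_unif_lt (s : seq R) r x : 0 < r ->
  (forall a, a \in s -> semiball a r x) ->
  exists2 d, 0 < d < r & forall a, a \in s -> semiball a (r - d) x.
Proof.
move=> r0; elim: s => [_|a s ih xs].
  by exists (r / 2) => //; apply/andP; split; lra.
have [|d dr ds] := ih; first by move=> b bs; apply: xs; rewrite inE bs orbT.
have [d' dr' ds'] := semiball_lt (xs a (mem_head _ _)) r0.
exists (Num.min d d') => [|b].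
  by rewrite lt_min gt_min; move: dr dr' => /andP[-> ->] /andP[-> ->].
rewrite inE => /orP[/eqP ->|bs].
  by apply: le_semiball ds'; rewrite lerD2l lerN2 ge_min lexx orbT.
by apply: le_semiball (ds _ bs); rewrite lerD2l lerN2 ge_min lexx.
Qed.

Lemma smooth_nbhs_filter (x : smooth) : ProperFilter (nbhs x).
Proof.
split.
  move=> [[s r] /= [_ r0]] /(_ x); apply => a _.
  by rewrite subrr; exact: semiball0.
apply: filter_from_filter; first by exists ([::], 1).
move=> [s r] [t u] /= [s0 r0] [t0 u0].
exists (s ++ t, Num.min r u) => /=.
  by rewrite lt_min r0 u0; split=> // a; rewrite mem_cat => /orP[/s0|/t0].
move=> y xy; split=> a ain.
  by apply: le_semiball (xy a _); rewrite ?ge_min ?lexx// mem_cat ain.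
by apply: le_semiball (xy a _); rewrite ?ge_min ?lexx ?orbT// mem_cat ain orbT.
Qed.

Lemma smooth_nbhs_singleton (x : smooth) (A : set smooth) : nbhs x A -> A x.
Proof.
move=> [[s r] /= [_ r0]]; apply => a _.
by rewrite subrr; exact: semiball0.
Qed.

Lemma smooth_ball_nbhs s r (x y : smooth) : (forall a, a \in s -> 0 <= a) ->
  0 < r -> smooth_ball s r x y -> nbhs y (smooth_ball s r x).
Proof.
move=> s0 r0 /(semiball_unif_lt r0)[d /andP[d0 dr] xd].
exists (s, d) => //= z yz a ain.
rewrite -(subrKA y) addrC -[r](subrK d).
by apply: semiballD; [exact: xd|exact: yz].
Qed.

Lemma smooth_nbhs_nbhs (x : smooth) (A : set smooth) :
  nbhs x A -> nbhs x (nbhs^~ A).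
Proof.
move=> [[s r] /= [s0 r0]] xA; exists (s, r) => //= y xy.
have := smooth_ball_nbhs s0 r0 xy.
by apply: (@filterS _ _ (smooth_nbhs_filter y)).
Qed.

HB.instance Definition _ := Nbhs_isNbhsTopological.Build smooth
  smooth_nbhs_filter smooth_nbhs_singleton smooth_nbhs_nbhs.

Lemma smooth_add_continuous :
  continuous (fun x : smooth * smooth => x.1 + x.2).
Proof.
move=> [x y] A /= [[s r] /= [s0 r0]] xA.
exists (smooth_ball s (r / 2) x, smooth_ball s (r / 2) y) => /=.
  by split; exists (s, r / 2) => //=; split=> //; rewrite divr_gt0.
move=> [x' y'] /= [xx' yy']; apply: xA => a ain.
rewrite opprD addrACA [r]splitr.
by apply: semiballD; [exact: xx'|exact: yy'].
Qed.

Lemma semiball_absorb (s : seq R) r x : 0 < r ->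
  (forall a, a \in s -> 0 <= a) ->
  exists2 k : R, 0 < k & forall (a : R) (c : R[i]), a \in s -> `|c| <= k%:C ->
    semiball a r (c *: x).
Proof.
move=> r0; elim: s => [_|a s ih s0]; first by exists 1.
have [|k k0 ks] := ih; first by move=> b bs; apply: s0; rewrite inE bs orbT.
have xs : smooth_set (val x) by apply/asboolP; exact: (valP x).
have [y xy] := xs a (s0 _ (mem_head _ _)).
have [n n0 yE] := ge0_complexE (normr_ge0 y).
have y1 : 0 < n + 1 by rewrite ltr_wpDl.
exists (Num.min k (r / (n + 1))).
  by rewrite lt_min k0 divr_gt0.
move=> b c; rewrite inE => /orP[/eqP ->|bs] ck; last first.
  by apply: ks => //; rewrite (le_trans ck)// lecR ge_min lexx.
exists (c *: y); first exact: abs_powZ.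
rewrite normrZ.
have {}ck : `|c| <= (r / (n + 1))%:C.
  by rewrite (le_trans ck)// lecR ge_min lexx orbT.
rewrite (le_lt_trans (ler_wpM2r _ ck))// yE -rmorphM ltcR.
by rewrite mulrAC ltr_pdivrMr// ltr_pM2l// ltrDl.
Qed.

Lemma smooth_scale_continuous :
  continuous (fun z : R[i]^o * smooth => z.1 *: z.2).
Proof.
move=> [c x] A /= [[s r] /= [s0 r0]] xA.
have r2 : 0 < r / 2 by rewrite divr_gt0.
have [k k0 ks] := semiball_absorb x r2 s0.
have [n n0 cE] := ge0_complexE (normr_ge0 c).
pose M := n + k.
have M0 : 0 < M by rewrite /M ltr_wpDl.
exists (ball c k%:C, smooth_ball s (r / 2 / M) x) => /=.
  split; first by apply: nbhsx_ballx; rewrite ltcR.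
  by exists (s, r / 2 / M) => //=; split=> //; rewrite !divr_gt0.
move=> [c' x'] /= [cc' xx']; apply: xA => a ain.
have -> : c' *: x' - c *: x = c' *: (x' - x) + (c' - c) *: x.
  by rewrite scalerBr scalerBl addrA subrK.
have {}cc' : `|c' - c| <= k%:C by rewrite distrC ltW.
rewrite [r]splitr; apply: semiballD; last exact: ks.
have -> : r / 2 = M * (r / 2 / M) by rewrite [RHS]mulrC divfK// gt_eqF.
apply: semiballZ => //; [by rewrite divr_gt0| |exact: xx'].
rewrite -[c'](subrK c) addrC.
have -> : M%:C = `|c| + k%:C by rewrite cE -rmorphD.
by rewrite (le_trans (ler_normD _ _))// lerD2l.
Qed.

Lemma smooth_locally_convex : exists2 B : set_system smooth,
  (forall b, b \in B -> convex_set b) & basis B.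
Proof.
exists [set b | exists s r x, [/\ forall a, a \in s -> 0 <= a, 0 < r &
    b = smooth_ball s r x]].
  move=> b /[!inE] -[s [r [x [s0 r0 ->]]]].
  apply/convex_setW => y z /[!inE] xy xz l l0 l1; rewrite inE => a ain.
  have [u yu ur] := xy _ ain; have [w zw wr] := xz _ ain.
  have -> : ((y : convex_lmodType smooth) <| l |> z : smooth) - x =
      l%:num *: (y - x) + (1 - l%:num) *: (z - x).
    rewrite !scalerBr addrACA -opprD -scalerDl [l%:num + _]addrC subrK.
    by rewrite scale1r.
  exists (l%:num *: u + (1 - l%:num) *: w).
    by apply: abs_powD; exact: abs_powZ.
  rewrite (le_lt_trans (ler_normD _ _))// !normrZ.
  rewrite (gtr0_norm l0) gtr0_norm ?subr_gt0//.
  have -> : r%:C = l%:num * r%:C + (1 - l%:num) * r%:C.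
    by rewrite -mulrDl addrC subrK mul1r.
  by rewrite ltrD// ltr_pM2l// subr_gt0.
split=> [b [s [r [x [s0 r0 ->]]]]|x A [[s r] /= [s0 r0]] xA].
  by rewrite openE => y xy; exact: smooth_ball_nbhs.
exists (smooth_ball s r x) => //; split; first by exists s, r, x.
by move=> a _; rewrite subrr; exact: semiball0.
Qed.

HB.instance Definition _ := PreTopologicalLmod_isTvs.Build R[i] smooth
  smooth_add_continuous smooth_scale_continuous smooth_locally_convex.
HB.instance Definition _ := PreTopologicalNmodule_isTopologicalNmodule.Build
  smooth smooth_add_continuous.
HB.instance Definition _ := TopologicalNmodule_isTopologicalLmodule.Build
  R[i] smooth smooth_scale_continuous.
HB.instance Definition _ := Uniform_isTvs.Build R[i] smooth
  smooth_locally_convex.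

End Smooth.
Arguments smooth {R H J} e mu.

Definition pure_tensors {X Y Z : Type} (t : X -> Y -> Z) : set Z :=
  [set z | exists x y, z = t x y].

Section CompletedTensor.
Context {K : numFieldType} {E F T : tvsType K}.
Implicit Types (t : E -> F -> T) (U : set E) (V : set F).

(* The absolutely convex hull of U (x) V. *)
Definition tensor_hull t U V : set T :=
  [set z | exists n (c : 'I_n -> K) (x : 'I_n -> E) (y : 'I_n -> F),
    [/\ forall i, U (x i), forall i, V (y i), \sum_i `|c i| <= 1 &
        z = \sum_i c i *: t (x i) (y i)]].

(* Cauchy for the translation-invariant uniformity; [tvsType] only requires
   some uniformity compatible with the topology. *)
Definition cauchy_filter (P : set_system T) : Prop :=
  forall W, nbhs (0 : T) W -> exists2 B, P B &
    forall u v, B u -> B v -> W (u - v).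

(* (T, t) is the completed projective tensor product of E and F: the hull of
   the pure tensors is the algebraic tensor product, on which T induces the
   projective topology (with the sets [tensor_hull t U V] as a base of
   neighbourhoods of 0), and T is its Hausdorff completion. *)
Record completed_tensor t : Prop := {
  ct_linearl : forall y, linear (t^~ y);
  ct_linearr : forall x, linear (t x);
  ct_algebraic : forall n (x : 'I_n -> E) (y : 'I_n -> F), lin_indep x ->
    \sum_i t (x i) (y i) = 0 -> forall i, y i = 0;
  ct_projective_le : forall W, nbhs (0 : T) W -> exists U V,
    [/\ nbhs 0 U, nbhs 0 V & tensor_hull t U V `<=` W];
  ct_projective_ge : forall U V, nbhs 0 U -> nbhs 0 V -> exists2 W,
    nbhs (0 : T) W & W `&` lin_hull (pure_tensors t) `<=` tensor_hull t U V;
  ct_dense : closure (lin_hull (pure_tensors t)) = setT;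
  ct_hausdorff : hausdorff_space T;
  ct_complete : forall P : set_system T, ProperFilter P -> cauchy_filter P ->
    exists z : T, P --> z;
}.

End CompletedTensor.

Section CStarAlgebras.
Context {R : realType}.
Implicit Types A B C : cstarType R.

Record star_hom A B (f : A -> B) : Prop := {
  sh_linear : linear f;
  sh_mul : forall a b, f (a ** b) = f a ** f b;
  sh_one : f cone = cone;
  sh_star : forall a, f (star a) = star (f a);
}.

Record faithful_rep A (H : hilbertType R) (rho : A -> H -> H) : Prop := {
  fr_op_linear : forall a, linear (rho a);
  fr_op_continuous : forall a, continuous (rho a);
  fr_linear : forall x, linear (rho^~ x);
  fr_mul : forall a b x, rho (a ** b) x = rho a (rho b x);
  fr_one : forall x, rho cone x = x;
  fr_star : forall a x y, dot (rho (star a) x) y = dot x (rho a y);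
  fr_faithful : forall a, (forall x, rho a x = 0) -> a = 0;
}.

Record hilbert_tensor (H1 H2 H : hilbertType R) (t : H1 -> H2 -> H) : Prop := {
  ht_linearl : forall y, linear (t^~ y);
  ht_linearr : forall x, linear (t x);
  ht_dot : forall x y x' y', dot (t x y) (t x' y') = dot x x' * dot y y';
  ht_dense : closure (lin_hull (pure_tensors t)) = setT;
}.

(* (C, t) is the minimal tensor product of A and B: the completion of the
   *-algebra of sums of pure tensors for the norm of operators on the tensor
   product of two Hilbert spaces on which A and B are faithfully represented. *)
Record min_tensor A B C (t : A -> B -> C) : Prop := {
  mt_linearl : forall b, linear (t^~ b);
  mt_linearr : forall a, linear (t a);
  mt_mul : forall a b a' b', t a b ** t a' b' = t (a ** a') (b ** b');
  mt_one : t cone cone = cone;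
  mt_star : forall a b, star (t a b) = t (star a) (star b);
  mt_dense : closure (lin_hull (pure_tensors t)) = setT;
  mt_spatial : exists (H1 H2 H : hilbertType R) (s : H1 -> H2 -> H)
      (rhoA : A -> H1 -> H1) (rhoB : B -> H2 -> H2) (rho : C -> H -> H),
    [/\ hilbert_tensor s, faithful_rep rhoA, faithful_rep rhoB,
        faithful_rep rho &
        forall a b x y, rho (t a b) (s x y) = s (rhoA a x) (rhoB b y)];
}.

End CStarAlgebras.

(* [cqg2] and [cqg3] are the minimal tensor square and cube of the algebra;
   [dl] and [dr] in [cqg_coassoc] are Delta (x) id and id (x) Delta. *)
Record cqg (R : realType) := CompactQuantumGroup {
  cqg_alg :> cstarType R;
  cqg2 : cstarType R;
  cqg3 : cstarType R;
  tens : cqg_alg -> cqg_alg -> cqg2;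
  tensl : cqg2 -> cqg_alg -> cqg3;
  tensr : cqg_alg -> cqg2 -> cqg3;
  Delta : cqg_alg -> cqg2;
  cqg_tens : min_tensor tens;
  cqg_tensl : min_tensor tensl;
  cqg_tensr : min_tensor tensr;
  cqg_tensA : forall a b c, tensl (tens a b) c = tensr a (tens b c);
  cqg_Delta : star_hom Delta;
  cqg_coassoc : exists dl dr : cqg2 -> cqg3,
    [/\ star_hom dl, forall a b, dl (tens a b) = tensl (Delta a) b,
        star_hom dr, forall a b, dr (tens a b) = tensr a (Delta b) &
        forall a, dl (Delta a) = dr (Delta a)];
  cqg_densel : closure (lin_hull
    [set z | exists a b, z = tens cone b ** Delta a]) = setT;
  cqg_denser : closure (lin_hull
    [set z | exists a b, z = tens b cone ** Delta a]) = setT;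
}.

Section QuantumGroup.
Context {R : realType} {G : cqg R}.

Record haar_state (h : G -> R[i]^o) : Prop := {
  haar_linear : linear h;
  haar_ge0 : forall a, 0 <= h (star a ** a);
  haar1 : h cone = 1;
  (* (h (x) id) Delta a = h a 1 = (id (x) h) Delta a *)
  haar_left : exists f : cqg2 G -> G, [/\ linear f, continuous f,
    forall a b, f (tens a b) = h a *: b & forall a, f (Delta a) = h a *: cone];
  haar_right : exists f : cqg2 G -> G, [/\ linear f, continuous f,
    forall a b, f (tens a b) = h b *: a & forall a, f (Delta a) = h a *: cone];
}.

(* [Lam] is the canonical map of G into the GNS space [L2] of [h]. *)
Record is_gns (h : G -> R[i]^o) (L2 : hilbertType R) (Lam : G -> L2) : Prop := {
  gns_linear : linear Lam;
  gns_dot : forall a b, dot (Lam a) (Lam b) = h (star b ** a);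
  gns_dense : closure (range Lam) = setT;
}.

Record finrep := FinRep { fdim : nat; fmx :> 'M[G]_fdim }.

Definition lmulmx m n p (s : 'M[R[i]]_(m, n)) (u : 'M[G]_(n, p)) : 'M[G]_(m, p) :=
  \matrix_(i, j) \sum_k s i k *: u k j.

Definition rmulmx m n p (u : 'M[G]_(m, n)) (s : 'M[R[i]]_(n, p)) : 'M[G]_(m, p) :=
  \matrix_(i, j) \sum_k s k j *: u i k.

Record unitary_rep (u : finrep) : Prop := {
  ur_rep : forall i j, Delta (u i j) = \sum_k tens (u i k) (u k j);
  ur_unitaryr : forall i j,
    \sum_k u i k ** star (u j k) = (i == j)%:R *: (cone : G);
  ur_unitaryl : forall i j,
    \sum_k star (u k i) ** u k j = (i == j)%:R *: (cone : G);
}.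

(* The range of the orthogonal projection p is an invariant subspace of u
   iff p u p = u p. *)
Definition irreducible_rep (u : finrep) : Prop :=
  (0 < fdim u)%N /\
  forall p : 'M[R[i]]_(fdim u), p *m p = p -> (map_mx Num.conj p)^T = p ->
    lmulmx p (rmulmx u p) = rmulmx u p -> p = 0 \/ p = 1%:M.

Definition equivalent_rep (u v : finrep) : Prop :=
  exists (s : 'M[R[i]]_(fdim u, fdim v)) (s' : 'M[R[i]]_(fdim v, fdim u)),
    [/\ s *m s' = 1%:M, s' *m s = 1%:M & rmulmx u s = lmulmx s v].

(* [pi] picks one representative in each class of the dual of G. *)
Record irr_system (I : Type) (pi : I -> finrep) : Prop := {
  irr_unitary : forall i, unitary_rep (pi i);
  irr_irreducible : forall i, irreducible_rep (pi i);
  irr_inj : forall i j, equivalent_rep (pi i) (pi j) -> i = j;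
  irr_complete : forall u, unitary_rep u -> irreducible_rep u ->
    exists i, equivalent_rep u (pi i);
}.

End QuantumGroup.
Arguments finrep {R} G.

Section SpectralTriple.
Context {R : realType} {G : cqg R} {L2 : hilbertType R} {I : choiceType}.
Variables (Lam : G -> L2) (pi : I -> finrep G) (lam : I -> R).

Definition coef_index : choiceType :=
  {i : I & ('I_(fdim (pi i)) * 'I_(fdim (pi i)))%type}.

Definition coef (j : coef_index) : G :=
  pi (tag j) (tagged j).1 (tagged j).2.

Definition poly_alg : set G := lin_hull (range coef).

Definition eigenvector (j : coef_index) : L2 := Lam (coef j).
Definition eigenvalue (j : coef_index) : R := lam (tag j).

Definition Dirac : set (L2 * L2) := diag_op eigenvector eigenvalue.
Definition absDirac : set (L2 * L2) := diag_op eigenvector (fun j => `|eigenvalue j|).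
Definition Cinfty : tvsType R[i] := smooth eigenvector eigenvalue.

(* Right multiplication by a in C[G] extends to a bounded operator on L2(G). *)
Definition right_mult (a : G) (M : L2 -> L2) : Prop :=
  [/\ linear M, continuous M & forall b, poly_alg b -> M (Lam b) = Lam (b ** a)].

(* [M] is the (bounded) left multiplication by the vector [x], i.e. maps
   [a] to [x a] for [a] in C[G]. *)
Definition left_mult (x : L2) (M : L2 -> L2) : Prop :=
  [/\ linear M, continuous M & forall a, poly_alg a ->
    exists2 N, right_mult a N & M (Lam a) = N x].

Record spectral_triple : Prop := {
  st_bounded : forall x : Cinfty, exists M, left_mult (val x) M;
  st_mul : forall (x y : Cinfty) M, left_mult (val x) M ->
    exists z : Cinfty, val z = M (val y);
  st_star : forall (x : Cinfty) M, left_mult (val x) M ->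
    exists (y : Cinfty) N, left_mult (val y) N /\
      forall u v, dot (M u) v = dot u (N v);
  st_discrete : discrete_spectrum Dirac;
  (* M maps Dom |D| into itself and [|D|, M] is bounded *)
  st_commutator : forall (x : Cinfty) M, left_mult (val x) M ->
    exists C : R, forall u v, absDirac (u, v) ->
      exists2 w, absDirac (M u, w) & `|w - M v| <= C%:C * `|u|;
}.

(* The sum of |lambda|^-b over the eigenvalues of D counted with
   multiplicity, the coefficients of [pi] being a basis of eigenvectors. *)
Definition summable_triple : Prop := exists2 b : R, 0 < b &
  (\esum_(j in [set: coef_index]) (`|eigenvalue j| `^ (- b))%:E < +oo)%E.

End SpectralTriple.

(* Main.v *)
(* (phi, psi) |-> (A phi) psi is bounded on U x U for some neighbourhood U of 0:
   C^oo is metrizable and the strong topology of its dual makes A phi uniformly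
   small on bounded sets, in particular on null sequences psi_k.  Such a form
   factors through the algebraic tensor product, is bounded there on a
   neighbourhood of 0 of the projective topology, and its graph closes up to
   that of the kernel K_A.

   The seminorms of C^oo are indexed by all real exponents; metrizability comes
   from the interpolation |mu|^(2a) <= 1 + |mu|^(2b) for 0 <= a <= b.  It applies
   because coefficients of inequivalent irreducible representations are
   orthogonal (Schur's lemma applied to Haar averages), so that the norm of a
   linear combination splits along the eigenvalues. *)

Require Import Defs.
From HB Require Import structures.
From mathcomp Require Import all_boot all_order all_algebra.
From mathcomp Require Import complex.
From mathcomp Require Import all_classical all_reals all_analysis.
From mathcomp Require Import lra ring.

Set Implicit Arguments.
Unset Strict Implicit.
Unset Printing Implicit Defensive.

Import Order.TTheory GRing.Theory Num.Theory.
Import numFieldNormedType.Exports.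

Local Open Scope classical_set_scope.
Local Open Scope ring_scope.
Local Open Scope complex_scope.

(** * Closures of linear graphs *)

Section Graphs.
Context {K : numFieldType} {V : tvsType K} {W : normedModType K}.
Implicit Types Γ : set (V * W).

Lemma closure_graph_bound Γ (N : set V) (r : K) v w : nbhs v N ->
  (forall v' w', Γ (v', w') -> N v' -> `|w'| <= r) ->
  closure Γ (v, w) -> `|w| <= r.
Proof.
move=> Nv bnd Γvw; apply/ler_addgt0Pr => e e0.
have [] := Γvw (N `*` ball w e).
  by exists (N, ball w e) => //; split=> //; exact: nbhsx_ballx.
move=> [v' w'] [Γvw' /= [Nv']]; rewrite -ball_normE/= => we.
rewrite -[w](subrK w') addrC (le_trans (ler_normD _ _))// lerD//.
  exact: bnd Γvw' Nv'.
exact: ltW.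
Qed.

(* Completeness of W turns the limit of a Cauchy filter of second components
   into the missing image of v. *)
Lemma closure_graph_total Γ (N : set V) :
  (forall P : set_system W, ProperFilter P -> cauchy_filter P ->
    exists z : W, P --> z) ->
  (forall p q, Γ p -> Γ q -> Γ (p - q)) ->
  (forall (c : K) p, Γ p -> Γ (c *: p)) ->
  nbhs (0 : V) N -> (forall v w, Γ (v, w) -> N v -> `|w| <= 1) ->
  forall v, closure [set v' | exists w, Γ (v', w)] v -> exists w, closure Γ (v, w).
Proof.
move=> Wc ΓB ΓZ N0 bnd v vc.
pose img (M : set V) := [set w | exists2 v', M v' & Γ (v', w)].
have PF : ProperFilter (filter_from (nbhs v) img).
  split.
    by move=> [M /vc[v' [[w Γw] Mv']]] /(_ w); apply; exists v'.
  apply: filter_from_filter; first by exists setT; exact: filterT.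
  move=> M M' vM vM'; exists (M `&` M'); first exact: filterI.
  by move=> w [v' [Mv' Mv''] Γw]; split; exists v'.
have [|w Pw] := Wc _ PF.
  move=> U /nbhs_ballP[e /= e0 eU].
  (* By homogeneity the bound 1 over [N] becomes [e / 2] over [c^-1 N]: first components with
     difference in [c^-1 N] have images at distance less than [e]. *)
  pose c := (e / 2)^-1.
  have e2 : 0 < e / 2 by rewrite divr_gt0.
  have c0 : 0 < c by rewrite invr_gt0.
  have [[M M'] /= [Mv Mv'] MN] : nbhs (v, v) [set p : V * V | N (c *: (p.1 - p.2))].
    have : nbhs (c *: (v - v)) N by rewrite subrr scaler0.
    move=> /(@scale_continuous K V (c, v - v))[[A B] /= [Ac B0] ABN].
    have cvB : nbhs (v, v) [set p : V * V | B (p.1 - p.2)] :=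
      @sub_continuous V (v, v) B B0.
    apply: filterS cvB => p /= Bp.
    by apply: (ABN (c, p.1 - p.2)); split=> //=; exact: nbhs_singleton.
  exists (img (M `&` M')); first by exists (M `&` M') => //; exact: filterI.
  move=> w w' [v1 [Mv1 _] Γ1] [v2 [_ Mv2] Γ2]; apply: eU.
  rewrite -ball_normE/= sub0r normrN.
  have /= := bnd _ _ (ΓZ c _ (ΓB _ _ Γ1 Γ2)) (MN (v1, v2) (conj Mv1 Mv2)).
  rewrite normrZ (gtr0_norm c0) ler_pdivrMl// mulr1 => /le_lt_trans; apply.
  by rewrite ltr_pdivrMr// ltr_pMr// ltr1n.
exists w => B [[B1 B2] /= [B1v B2w] B12].
have [M vM MB2] := Pw _ B2w.
have [v' [[w' Γ'] [Mv' Bv']]] := vc _ (filterI vM B1v).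
by exists (v', w'); split=> //; apply: B12; split=> //=; apply: MB2; exists v'.
Qed.

End Graphs.

(** * Cauchy filters in Hilbert spaces and in the complex numbers *)

Section Completeness.
Context {R : realType}.

Lemma complete_cauchy_filter (H : hilbertType R) (P : set_system H) :
  ProperFilter P -> cauchy_filter P -> exists z : H, P --> z.
Proof.
move=> PF PC; exists (lim P); apply: cauchy_cvg.
apply/cauchyP => e e0.
have [|B PB Be] := PC (ball (0 : H) e); first exact: nbhsx_ballx.
have [x Bx] := filter_ex PB.
exists x; apply: filterS PB => y By.
by have := Be _ _ Bx By; rewrite -!ball_normE /= sub0r normrN.
Qed.

(** Real and imaginary parts are additive and bounded by the modulus, so each maps [P] to a Cauchy
    filter on the complete space [R]. *)
Lemma complex_cauchy_filter (P : set_system R[i]^o) :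
  ProperFilter P -> cauchy_filter P -> exists z : R[i]^o, P --> z.
Proof.
move=> PF PC.
have RI0 (z w : R[i]) : complex.Re (z - w) = complex.Re z - complex.Re w /\
  complex.Im (z - w) = complex.Im z - complex.Im w by case: z w => [a b] [c d].
have cauchy_part (f : R[i]^o -> R) :
    (forall z w, f (z - w) = f z - f w) -> (forall z, `|f z|%:C <= `|z|) ->
    cauchy (f @ P).
  move=> fB fle; apply/cauchyP => e e0.
  have eC : 0 < e%:C by rewrite ltcR.
  have [|B PB Be] := PC (ball (0 : R[i]^o) e%:C); first exact: nbhsx_ballx.
  have [x Bx] := filter_ex PB.
  exists (f x); change (P [set y | ball (f x) e (f y)]).
  apply: filterS PB => y By.
  have := Be _ _ Bx By; rewrite -!ball_normE /= sub0r normrN => xye.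
  by rewrite -ltcR -fB (le_lt_trans (fle _)).
have [fr fi] : cauchy ((@complex.Re R : R[i]^o -> R) @ P) /\
  cauchy ((@complex.Im R : R[i]^o -> R) @ P).
  split; apply: cauchy_part.
  - by move=> z w; rewrite (RI0 z w).1.
  - by move=> z; exact: normc_ge_Re.
  - by move=> z w; rewrite (RI0 z w).2.
  - move=> [a b]/=; rewrite normc_def/= lecR -sqrtr_sqr ler_wsqrtr// lerDr.
    exact: sqr_ge0.
have [l lr] : exists l : R, (@complex.Re R : R[i]^o -> R) @ P --> l.
  by eexists; exact: (@cauchy_cvg R _ _ fr).
have [m mi] : exists m : R, (@complex.Im R : R[i]^o -> R) @ P --> m.
  by eexists; exact: (@cauchy_cvg R _ _ fi).
exists (l +i* m); move=> U /nbhs_ballP[e /= e0 eU].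
have [e' e'0 eE] : exists2 e' : R, 0 < e' & e = e'%:C.
  have [e' _ eE] := ge0_complexE (ltW e0); exists e' => //.
  by rewrite -ltcR -eE.
have e2 : 0 < e' / 2 by rewrite divr_gt0.
have Hr : \forall z \near P, `|l - complex.Re z| < e' / 2.
  by move/cvgrPdist_lt : lr; exact.
have Hi : \forall z \near P, `|m - complex.Im z| < e' / 2.
  by move/cvgrPdist_lt : mi; exact.
apply: filterS2 Hr Hi => -[a b] /= la mb; apply: eU; rewrite -ball_normE/=.
have -> : (l +i* m) - (a +i* b) = ((l - a) +i* 0) + (0 +i* (m - b)) by simpc.
rewrite (le_lt_trans (ler_normD _ _))//.
rewrite !normc_def/= !expr0n/= !addr0 !add0r !sqrtr_sqr eE -rmorphD ltcR.
by rewrite [e']splitr ltrD.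
Qed.

End Completeness.

(** * Norms of combinations of eigenvectors *)

Section HilbertSpace.
Context {R : realType} {H : hilbertType R}.
Implicit Types (x y z : H) (a : R[i]).

Lemma dotDl x y z : dot (x + y) z = dot x z + dot y z.
Proof. by have := dot_linear 1 x y z; rewrite scale1r mul1r. Qed.

Lemma dot0l x : dot 0 x = 0 :> R[i].
Proof. by apply: (addIr (dot 0 x)); rewrite -dotDl !add0r. Qed.

Lemma dotZl a x y : dot (a *: x) y = a * dot x y.
Proof. by have := dot_linear a x 0 y; rewrite addr0 dot0l addr0. Qed.

Lemma dotZr a x y : dot x (a *: y) = Num.conj a * dot x y.
Proof. by rewrite dot_conj dotZl rmorphM [in RHS]dot_conj. Qed.

Lemma dot_suml n (f : 'I_n -> H) y : dot (\sum_i f i) y = \sum_i dot (f i) y.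
Proof.
elim/big_ind2 : _ => [|_ u _ v <- <-|//]; first exact: dot0l.
exact: dotDl.
Qed.

Lemma dot_sumr n (f : 'I_n -> H) x : dot x (\sum_i f i) = \sum_i dot x (f i).
Proof.
rewrite dot_conj dot_suml rmorph_sum.
by apply: eq_bigr => i _; rewrite [RHS]dot_conj.
Qed.

Variables (J : Type) (e : J -> H) (mu : J -> R).
Hypothesis e_orth : forall j k, mu j != mu k -> dot (e j) (e k) = 0.

(** The diagonal operator with eigenvalues [f (mu j)], applied to a combination of the [e j]. *)
Definition diag_sum (f : R -> R) n (c : 'I_n -> R[i]) (j : 'I_n -> J) : H :=
  \sum_k c k *: ((f (mu (j k)))%:C *: e (j k)).

(** Terms pairing different eigenvalues vanish, and for equal eigenvalues the two real factors merge
    into a square. The squared norm is thus linear in [f ^+ 2]. *)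
Lemma diag_sum_norm f n (c : 'I_n -> R[i]) (j : 'I_n -> J) :
  `|diag_sum f c j| ^+ 2 = \sum_k \sum_l
    (f (mu (j k)) ^+ 2)%:C * (c k * Num.conj (c l) * dot (e (j k)) (e (j l))).
Proof.
rewrite -dot_norm dot_suml; apply: eq_bigr => k _.
rewrite dot_sumr; apply: eq_bigr => l _; rewrite !(dotZl, dotZr).
have [->|/e_orth ->] := eqVneq (mu (j k)) (mu (j l)); last by rewrite !mulr0.
rewrite (_ : Num.conj (f (mu (j l)))%:C = (f (mu (j l)))%:C); last first.
  by apply/conj_Creal/complex_realP; eexists.
by rewrite expr2 rmorphM/=; ring.
Qed.

(* For real f, g, h with f^2 <= g^2 + h^2, the difference of the two sides
   below is the squared norm of [diag_sum (sqrt (g^2 + h^2 - f^2))]. *)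
Lemma diag_sum_le f g h n (c : 'I_n -> R[i]) (j : 'I_n -> J) :
  (forall k, f (mu k) ^+ 2 <= g (mu k) ^+ 2 + h (mu k) ^+ 2) ->
  `|diag_sum f c j| <= `|diag_sum g c j| + `|diag_sum h c j|.
Proof.
move=> fgh.
pose d t := Num.sqrt (g t ^+ 2 + h t ^+ 2 - f t ^+ 2).
have sq : `|diag_sum f c j| ^+ 2 <= `|diag_sum g c j| ^+ 2 + `|diag_sum h c j| ^+ 2.
  rewrite -subr_ge0 (_ : _ - _ = `|diag_sum d c j| ^+ 2) ?exprn_ge0//.
  rewrite !diag_sum_norm -big_split -sumrB; apply: eq_bigr => k _ /=.
  rewrite -big_split -sumrB; apply: eq_bigr => l _ /=.
  by rewrite sqr_sqrtr ?subr_ge0// rmorphB rmorphD/=; ring.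
rewrite -(@ler_pXn2r _ 2)// ?nnegrE ?addr_ge0//.
by rewrite (le_trans sq)// sqrrD lerD2r lerDl mulrn_wge0 ?mulr_ge0.
Qed.

End HilbertSpace.

Lemma lin_hull_family {K : numFieldType} {V : lmodType K} (J : Type)
    (E : J -> V) (p : V) :
  lin_hull [set v | exists j, v = E j] p <->
  exists n (c : 'I_n -> K) (j : 'I_n -> J), p = \sum_k c k *: E (j k).
Proof.
split=> [[n [c [s [/(_ _)/cid-/all_sig[j jE] ->]]]]|[n [c [j ->]]]].
  by exists n, c, j; apply: eq_bigr => k _; rewrite jE.
by exists n, c, (fun k => E (j k)); split=> // k; exists (j k).
Qed.

Lemma lincomb_pair {K : numFieldType} {V W : lmodType K} n (c : 'I_n -> K)
    (f : 'I_n -> V) (g : 'I_n -> W) :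
  \sum_k c k *: (f k, g k) = (\sum_k c k *: f k, \sum_k c k *: g k).
Proof.
by rewrite [LHS]surjective_pairing !raddf_sum.
Qed.

(** * Interpolation of the seminorms and a countable base at 0 *)

Section Interpolation.
Context {R : realType} {H : hilbertType R} {J : Type}.
Variables (e : J -> H) (mu : J -> R).
Hypothesis e_orth : forall j k, mu j != mu k -> dot (e j) (e k) = 0.

(** On the linear hull the operator is the identity, since a power of exponent 0 is 1, and the
    diagonal is closed. *)
Lemma abs_pow0_eq x y : abs_pow e mu 0 (x, y) -> y = x.
Proof.
have cl : closed [set p : H * H | p.1 - p.2 = 0].
  apply: (@closed_comp _ _ (fun p : H * H => p.1 - p.2) [set 0]).
    by move=> p _; exact: sub_continuous.
  exact/accessible_closed_set1/hausdorff_accessible/norm_hausdorff.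
move=> xy; apply/esym/subr0_eq; apply: (cl (x, y)); apply: closure_subset xy => p.
move=> /lin_hull_family[n [c [j ->]]] /=.
rewrite lincomb_pair/= -sumrB big1// => k _.
by rewrite powRr0 scale1r subrr.
Qed.

(** For [t <= 1] the constant term dominates, for [t > 1] the power of exponent [b] does. *)
Lemma powR_interp (a b t : R) : 0 <= a -> a <= b -> 0 <= t ->
  (t `^ a) ^+ 2 <= (t `^ 0) ^+ 2 + (t `^ b) ^+ 2.
Proof.
move=> a0 ab t0; rewrite powRr0 expr1n.
have [t1|t1] := leP t 1.
  rewrite ler_wpDr ?sqr_ge0// expr_le1 ?powR_ge0//.
  by have := ge0_ler_powR a0 t0 (@ler01 R) t1; rewrite powR1.
by rewrite ler_wpDl// lerXn2r ?nnegrE ?powR_ge0// ler_powR// ltW.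
Qed.

(** The bound on combinations controls [|D|^a v] by [v] and [|D|^b v] together, so [Γ] is a graph
    over the pairs [(v, |D|^b v)]. Its closure yields an image of [x] under [|D|^a] that inherits
    the bound. *)
Lemma semiball_interp a b r (x : smooth e mu) : 0 <= a -> a <= b -> 0 < r ->
  semiball 0 (r / 4) x -> semiball b (r / 4) x -> semiball a r x.
Proof.
move=> a0 ab r0 [x' xx' x'r] [y xy yr].
move: (abs_pow0_eq xx') x'r => -> xr {x' xx'}.
pose F (s : R) j : H := (`|mu j| `^ s)%:C *: e j.
pose Γ := lin_hull [set p | exists j, p = ((e j, F b j), F a j)].
pose N (k : R[i]) : set (H * H) := [set p | `|p.1| < k /\ `|p.2| < k].
have Nnbhs k p : N k p -> nbhs p (N k).
  have ball_nbhs (z : H) : `|z| < k -> nbhs z [set z' : H | `|z'| < k].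
    move=> zk; apply/nbhs_ballP; exists (k - `|z|); first by rewrite /= subr_gt0.
    move=> z'; rewrite -ball_normE/= distrC ltrBrDr -{2}[z'](subrK z) => zz'.
    exact: le_lt_trans (ler_normD _ _) zz'.
  move: p => [p q] [/ball_nbhs pk /ball_nbhs qk].
  by exists ([set z : H | `|z| < k], [set z : H | `|z| < k]).
have Γbnd k v z : Γ (v, z) -> N k v -> `|z| <= k + k.
  move=> /lin_hull_family[n [c [j vz]]].
  move: vz; rewrite !lincomb_pair => -[-> ->] [/= k1 k2].
  have := @diag_sum_le _ _ _ e mu e_orth (fun t => `|t| `^ a) (fun t => `|t| `^ 0)
    (fun t => `|t| `^ b) n c j (fun j => powR_interp a0 ab (normr_ge0 (mu j))).
  move=> /le_trans; apply; rewrite lerD ?(ltW k2)// (le_trans _ (ltW k1))//.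
  rewrite le_eqVlt; apply/orP; left; apply/eqP; congr (`|_|).
  by apply: eq_bigr => i _; rewrite powRr0 scale1r.
have xyΓ : closure [set v | exists z, Γ (v, z)] (x : H, y).
  apply: closure_subset xy => p /lin_hull_family[n [c [j ->]]].
  exists (\sum_k c k *: F a (j k)); apply/lin_hull_family; exists n, c, j.
  by rewrite !lincomb_pair.
have [z Γz] : exists z, closure Γ ((x : H, y), z).
  apply: (@closure_graph_total _ _ _ Γ (N (1 / 2))) xyΓ.
  - exact: complete_cauchy_filter.
  - by move=> p q Γp Γq; apply: lin_hullD => //; rewrite -scaleN1r; exact: lin_hullZ.
  - by move=> c p; exact: lin_hullZ.
  - by apply: Nnbhs; split; rewrite normr0 divr_gt0.
  - by move=> v w; rewrite [leRHS]splitr; exact: Γbnd.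
exists z.
  move=> B [[B1 B2] /= [xB1 zB2] B12].
  have [|[[x' y'] z'] [Γ' [/= B1x B2z]]] := Γz ((fst @^-1` B1) `*` B2).
    exists (fst @^-1` B1, B2) => //; split=> //=.
    exact: cvg_fst.
  exists (x', z'); split; last exact: B12.
  move: Γ' => /lin_hull_family[n [c [j E]]]; apply/lin_hull_family; exists n, c, j.
  by move: E; rewrite !lincomb_pair => -[-> _ ->].
(* Passing to the closure keeps only a non-strict bound [r / 4 + r / 4]; this leaves room for the
   strict bound [r]. *)
have r4 : r / 2 = r / 4 + r / 4 by lra.
apply: (@le_lt_trans _ _ (r / 2)%:C); last first.
  by rewrite ltcR ltr_pdivrMr// ltr_pMr// ltr1n.
rewrite r4 rmorphD; apply: (closure_graph_bound (Nnbhs (r / 4)%:C _ _) _ Γz) => //.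
by move=> v w; exact: Γbnd.
Qed.

(* By interpolation the seminorms of exponents 0 and k dominate those of all
   exponents between 0 and k, whence a countable base at 0. *)
Definition smooth_base (k : nat) : set (smooth e mu) :=
  smooth_ball [:: 0; k%:R] k.+1%:R^-1 0.

Lemma smooth_base_nbhs k : nbhs 0 (smooth_base k).
Proof.
exists ([:: 0; k%:R], k.+1%:R^-1) => //=; split; last by rewrite invr_gt0.
by move=> a; rewrite !inE => /orP[]/eqP ->.
Qed.

(** A neighbourhood involves finitely many exponents. Interpolation handles them all once [k]
    exceeds each of them and [k.+1%:R^-1 <= r / 4]. *)
Lemma smooth_base_subset (U : set (smooth e mu)) : nbhs 0 U ->
  \forall k \near \oo, smooth_base k `<=` U.
Proof.
move=> [[s r] /= [s0 r0] sU].
have [m ms] : exists m : nat, forall a, a \in s -> a <= m%:R.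
  elim: s {s0 sU} => [|a s [m ms]]; first by exists 0%N.
  exists (maxn m (Num.truncn a).+1) => b; rewrite inE => /orP[/eqP ->|/ms bm].
    rewrite (le_trans (ltW (truncnS_gt a)))// ler_nat leq_maxr//.
  by rewrite (le_trans bm)// ler_nat leq_maxl.
have r4 : 0 < r / 4 by rewrite divr_gt0.
near=> k => x kx; apply: sU => a ain; rewrite subr0.
have kr : k.+1%:R^-1 <= r / 4.
  by apply: ltW; near: k; exact: (near_infty_natSinv_lt (PosNum r4)).
have mk : (m <= k)%N by near: k; exact: nbhs_infty_ge.
have := kx 0; have := kx k%:R; rewrite subr0 !inE !eqxx orbT.
move=> /(_ isT) xk /(_ isT) x0.
apply: (@semiball_interp a k%:R) => //; [exact: s0| |exact: le_semiball x0
  |exact: le_semiball xk].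
by rewrite (le_trans (ms _ ain))// ler_nat.
Unshelve. all: by end_near. Qed.

End Interpolation.

(** * Joint boundedness from continuity into the strong dual *)

Section BilinearForms.
Context {K : numFieldType}.

(** Small multiples of the tail lie in [U] by joint continuity of scaling at [(0, 0)]. The finitely
    many other terms are absorbed one by one, and the radii add up. *)
Lemma cvg0_vN_bounded (E : tvsType K) (u : nat -> E) :
  u @ \oo --> (0 : E) -> vN_bounded (range u).
Proof.
move=> u0 U U0.
have : nbhs ((0 : K^o) *: (0 : E)) U by rewrite scaler0.
move=> /(@scale_continuous K E (0, 0))[[A B] /= [A0 B0] ABU].
have [d /= d0 dA] : exists2 d : K, 0 < d & ball (0 : K^o) d `<=` A.
  by move/nbhs_ballP : A0.
have [m _ mB] : \forall k \near \oo, B (u k) by exact: u0.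
have absorb x : exists2 r : K, 0 < r & forall z, r <= `|z| -> U (z^-1 *: x).
  have : nbhs ((0 : K^o) *: x) U by rewrite scale0r.
  move=> /(@scale_continuous K E (0, x))[[A' B'] /= [A'0 B'x] ABU'].
  have [d' /= d'0 dA'] : exists2 d : K, 0 < d & ball (0 : K^o) d `<=` A'.
    by move/nbhs_ballP : A'0.
  have d2 : 0 < d' / 2 by rewrite divr_gt0.
  exists (d' / 2)^-1; first by rewrite invr_gt0.
  move=> z dz; apply: (ABU' (z^-1, x)); split=> /=; last exact: nbhs_singleton.
  apply: dA'; rewrite -ball_normE/= sub0r normrN normfV.
  have z0 : 0 < `|z| by rewrite (lt_le_trans _ dz)// invr_gt0.
  rewrite (@le_lt_trans _ _ (d' / 2))//.
    by rewrite -[leRHS]invrK lef_pV2 ?posrE// invr_gt0.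
  by rewrite ltr_pdivrMr// ltr_pMr// ltr1n.
have [r r0 rU] : exists2 r : K, 0 < r &
    forall z k, r <= `|z| -> (k < m)%N -> U (z^-1 *: u k).
  elim: (m) => [|n [r r0 rU]]; first by exists 1.
  have [r' r'0 rU'] := absorb (u n).
  exists (r + r'); first exact: addr_gt0.
  move=> z k rz; rewrite ltnS leq_eqVlt => /predU1P[->|kn].
    by apply: rU'; rewrite (le_trans _ rz)// lerDr ltW.
  by apply: rU => //; rewrite (le_trans _ rz)// lerDl ltW.
have d2 : 0 < d / 2 by rewrite divr_gt0.
exists (r + (d / 2)^-1); first by rewrite addr_gt0// invr_gt0.
move=> z rz _ [k _ <-].
have dz : (d / 2)^-1 <= `|z| by rewrite (le_trans _ rz)// lerDr ltW.
have z0 : 0 < `|z| by rewrite (lt_le_trans _ dz)// invr_gt0.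
exists (z^-1 *: u k); last first.
  by rewrite scalerA divff ?scale1r// -normr_gt0.
have [km|mk] := ltnP k m.
  by apply: rU => //; rewrite (le_trans _ rz)// lerDl invr_ge0 ltW.
apply: (ABU (z^-1, u k)); split=> /=; last exact: mB.
apply: dA; rewrite -ball_normE/= sub0r normrN normfV.
rewrite (@le_lt_trans _ _ (d / 2))//.
  by rewrite -[leRHS]invrK lef_pV2 ?posrE// invr_gt0.
by rewrite ltr_pdivrMr// ltr_pMr// ltr1n.
Qed.

(** The polar of [B] contains the unit ball at 0 of uniform convergence on [B]. *)
Lemma dual_nbhs0 (E : tvsType K) (B : set E) : vN_bounded B ->
  nbhs (0 : dual E) [set f | forall x, B x -> `|f x| <= 1].
Proof.
move=> Bb.
have ent : entourage [set p : K^o * K^o | ball p.1 1 p.2].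
  exact: (entourage_ball _ (PosNum (ltr01 : 0 < 1 :> K))).
pose i (f : dual E) : {family vN_bounded, E -> K^o} := dual_fun f.
have i0 : nbhs (0 : dual E) [set f | forall x, B x -> ball (i 0 x) 1 (i f x)] :=
  @initial_continuous _ _ i (0 : dual E) _ (fam_nbhs _ ent Bb).
apply: filterS i0 => f /= fB x Bx.
have := fB x Bx; rewrite -ball_normE => fx.
have {}fx : `|0 - f x| < 1 := fx.
by rewrite -normrN -sub0r ltW.
Qed.

(* Only sequences matter for metrizable E, and a null sequence is bounded:
   the strong topology of the dual makes A uniformly small on it. *)
Lemma strong_continuous_bilinear (E : tvsType K) (V : nat -> set E)
    (A : {linear E -> dual E}) :
  (forall k, nbhs 0 (V k)) ->
  (forall U, nbhs (0 : E) U -> \forall k \near \oo, V k `<=` U) ->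
  continuous A ->
  exists2 U, nbhs (0 : E) U & forall x y, U x -> U y -> `|A x y| <= 1.
Proof.
move=> V0 VU cA; apply: contrapT => nU.
have /(_ _)/cid-/all_sig[p pP] k : exists p : E * E,
    [/\ V k p.1, V k p.2 & ~ `|A p.1 p.2| <= 1].
  apply: contrapT => nk; apply: nU; exists (V k) => // x y xk yk.
  by apply: contrapT => xy; apply: nk; exists (x, y).
have p2 : (fun k => (p k).2) @ \oo --> (0 : E).
  move=> U /VU; apply: filterS => k kU; apply: kU; by case: (pP k).
have p1 : (fun k => (p k).1) @ \oo --> (0 : E).
  move=> U /VU; apply: filterS => k kU; apply: kU; by case: (pP k).
(* From some [k] on, [A] maps the first sequence into the polar of the second; evaluating at the
   same index contradicts the choice of [p k]. *)
have := dual_nbhs0 (cvg0_vN_bounded p2); rewrite -[X in nbhs X _](linear0 A).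
move=> /cA/p1[k _ /(_ k (leqnn k)) kA].
by case: (pP k) => _ _; apply; apply: kA; exists k.
Qed.

End BilinearForms.

(** * Extension of bounded bilinear forms to the completed tensor product *)

Section TensorExtension.
Context {R : realType} {E F T : tvsType R[i]}.
Variables (t : E -> F -> T) (b : E -> F -> R[i]^o).
Hypotheses (tP : completed_tensor t).
Hypotheses (bl : forall y, linear (b^~ y)) (br : forall x, linear (b x)).

Lemma linear_lincombl (W : lmodType R[i]) (f : E -> F -> W) :
  (forall y, linear (f^~ y)) -> forall n (c : 'I_n -> R[i]) (x : 'I_n -> E) y,
  f (\sum_i c i *: x i) y = \sum_i c i *: f (x i) y.
Proof.
move=> fl n c x y.
pose g : {linear E -> W} := HB.pack (f^~ y) (GRing.isLinear.Build _ _ _ _ _ (fl y)).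
rewrite -[LHS]/(g _) linear_sum; apply: eq_bigr => i _.
by rewrite linearZ.
Qed.

Lemma not_lin_indep (V : lmodType R[i]) n (x : 'I_n.+1 -> V) : ~ lin_indep x ->
  exists k (d : 'I_n -> R[i]), x k = \sum_i d i *: x (lift k i).
Proof.
move=> /existsNP[c /not_implyP[cx /existsNP[k /eqP ck]]].
exists k, (fun i => - ((c k)^-1 * c (lift k i))).
move: cx; rewrite (bigD1_ord k)//= => /(congr1 (fun v => (c k)^-1 *: v)).
rewrite scaler0 scalerDr scalerA mulVf// scale1r => /eqP.
rewrite addr_eq0 => /eqP ->; rewrite scaler_sumr -sumrN.
by apply: eq_bigr => i _; rewrite scalerA scaleNr.
Qed.

(** Induction on the number of terms: independent [x i] force all [y i] to vanish, and a dependent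
    [x k] is eliminated by the same rewriting for [t] and for [b]. *)
Lemma bilinear_factor n (x : 'I_n -> E) (y : 'I_n -> F) :
  \sum_i t (x i) (y i) = 0 -> \sum_i b (x i) (y i) = 0.
Proof.
elim: n x y => [x y _|n ih x y txy]; first by rewrite big_ord0.
have [xi|/not_lin_indep[k [d xk]]] := pselect (lin_indep x).
  have y0 := ct_algebraic tP xi txy.
  rewrite big1// => i _; rewrite y0.
  by have := br (x i) (-1) 0 0; rewrite scaler0 add0r scaleN1r addNr.
have elim_k (W : lmodType R[i]) (f : E -> F -> W) :
    (forall y, linear (f^~ y)) -> (forall x, linear (f x)) ->
    \sum_i f (x i) (y i) = \sum_i f (x (lift k i)) (d i *: y k + y (lift k i)).
  move=> fl fr; rewrite (bigD1_ord k)//= xk (linear_lincombl fl) -big_split.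
  by apply: eq_bigr => i _; rewrite /= fr.
rewrite (elim_k _ b)//; apply: ih; rewrite -(elim_k _ t)//.
  exact: ct_linearl tP.
exact: ct_linearr tP.
Qed.

(** The linearization of [b] on the algebraic tensor product, kept as a relation because a tensor
    has many representations. *)
Definition bilinear_graph : set (T * R[i]^o) :=
  lin_hull [set p | exists xy : E * F, p = (t xy.1 xy.2, b xy.1 xy.2)].

Lemma bilinear_graph0 v : bilinear_graph (0, v) -> v = 0.
Proof.
move=> /lin_hull_family[n [c [xy]]]; rewrite lincomb_pair => -[/esym t0 ->].
have scale (W : lmodType R[i]) (f : E -> F -> W) : (forall y, linear (f^~ y)) ->
    \sum_i c i *: f (xy i).1 (xy i).2 = \sum_i f (c i *: (xy i).1) (xy i).2.
  move=> fl; apply: eq_bigr => i _.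
  have := linear_lincombl fl (fun=> c i) (fun _ : 'I_1 => (xy i).1) (xy i).2.
  by rewrite !big_ord1.
rewrite (scale _ b)//; apply: bilinear_factor; rewrite -(scale _ t)//.
exact: ct_linearl tP.
Qed.

Lemma bilinear_graphB p q :
  bilinear_graph p -> bilinear_graph q -> bilinear_graph (p - q).
Proof.
by move=> ? ?; apply: lin_hullD => //; rewrite -scaleN1r; exact: lin_hullZ.
Qed.

(** On algebraic tensors in [W] the form is at most 1, by the absolutely convex combinations of the
    projective topology. Density and completeness then make the closed graph total, and the bound
    makes it single-valued and continuous. *)
Lemma completed_tensor_extend U V : nbhs (0 : E) U -> nbhs (0 : F) V ->
  (forall x y, U x -> V y -> `|b x y| <= 1) ->
  exists f : dual T, forall x y, b x y = f (t x y).
Proof.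
move=> U0 V0 bUV; have [W W0 WUV] := ct_projective_ge tP U0 V0.
have bnd z v : bilinear_graph (z, v) -> W z -> `|v| <= 1.
  move=> zv Wz.
  have zh : lin_hull (pure_tensors t) z.
    move: zv => /lin_hull_family[n [c [xy]]]; rewrite lincomb_pair => -[-> _].
    by exists n, c, (fun i => t (xy i).1 (xy i).2); split=> // i; exists (xy i).1, (xy i).2.
  have [n [c [x [y [Ux Vy c1 zE]]]]] := WUV _ (conj Wz zh).
  (* Single-valuedness allows [v] to be computed from the representation of [z] in the hull instead
     of the one in the graph. *)
  have vE : v = \sum_i c i *: b (x i) (y i).
    have q : bilinear_graph (z, \sum_i c i *: b (x i) (y i)).
      apply/lin_hull_family; exists n, c, (fun i => (x i, y i)).
      by rewrite lincomb_pair zE.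
    apply/subr0_eq/bilinear_graph0; rewrite -(subrr z).
    exact: (bilinear_graphB zv q).
  rewrite vE (le_trans (ler_norm_sum _ _ _))// (le_trans _ c1)// ler_sum// => i _.
  by rewrite normrZ ler_piMr// bUV.
have clB p q : closure bilinear_graph p -> closure bilinear_graph q ->
    closure bilinear_graph (p + q).
  by apply: closure_addr => u v; exact: lin_hullD.
have clZ (c : R[i]) p : closure bilinear_graph p -> closure bilinear_graph (c *: p).
  by apply: closure_scaler => u; exact: lin_hullZ.
have clbnd z v : closure bilinear_graph (z, v) -> nbhs z W -> `|v| <= 1.
  by move=> zv Wz; exact: closure_graph_bound Wz bnd zv.
(* The fibre over 0 is stable under scaling and bounded by 1, hence trivial. *)
have cl0 v : closure bilinear_graph (0, v) -> v = 0.
  move=> v0; apply/eqP; rewrite -normr_eq0; apply/eqP/le_anti; rewrite normr_ge0 andbT.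
  apply/ler_addgt0Pr => e e0; rewrite add0r.
  have := clbnd _ _ (clZ e^-1 _ v0); rewrite /= scaler0 normrZ => /(_ W0).
  by rewrite normfV (gtr0_norm e0) ler_pdivrMl// mulr1.
have total z : exists v, closure bilinear_graph (z, v).
  apply: (@closure_graph_total _ _ _ bilinear_graph W) => //.
  - exact: complex_cauchy_filter.
  - exact: bilinear_graphB.
  - by move=> c p; exact: lin_hullZ.
  - have : closure (lin_hull (pure_tensors t)) z by rewrite (ct_dense tP).
    apply: closure_subset => _ [n [c [s [sP ->]]]].
    have /(_ _)/cid-/all_sig[xy xyE] i : exists xy : E * F, s i = t xy.1 xy.2.
      by have [x [y sE]] := sP i; exists (x, y).
    exists (\sum_i c i *: b (xy i).1 (xy i).2); apply/lin_hull_family.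
    exists n, c, xy; rewrite lincomb_pair; congr pair.
    by apply: eq_bigr => i _; rewrite xyE.
have [f fP] := choice total.
have uniq z v v' : closure bilinear_graph (z, v) -> closure bilinear_graph (z, v') -> v = v'.
  move=> zv zv'; apply/subr0_eq/cl0; rewrite -(subrr z) -[v - v']/((z, v) - (z, v')).2.
  by have := clB _ _ zv (clZ (-1) _ zv'); rewrite scaleN1r.
have lf : linear (f : T -> R[i]^o).
  move=> c u v; apply: uniq (fP _) _.
  exact: clB (clZ c _ (fP u)) (fP v).
have cf : continuous (f : T -> R[i]^o).
  move=> z; apply/cvgrPdist_le => e e0.
  (* The interior is used because [clbnd] asks [W] to be a neighbourhood of the point, not only to
     contain it. *)
  have : nbhs (e^-1 *: (z - z)) W^° by rewrite subrr scaler0; exact: nbhs_interior.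
  move=> /(@scale_continuous _ T (e^-1, z - z))[[A B] /= [Ae Bz] ABW].
  have zB : nbhs (z, z) [set p : T * T | B (p.1 - p.2)] :=
    @sub_continuous T (z, z) B Bz.
  have {zB}[[C D] /= [Cz Dz] CDB] := zB.
  apply: filterS Dz => u Du.
  have Wu : nbhs (e^-1 *: (z - u)) W.
    apply: (ABW (e^-1, z - u)); split=> /=; first exact: nbhs_singleton.
    by apply: (CDB (z, u)); split=> //=; exact: nbhs_singleton.
  have := clbnd _ _ (clZ e^-1 _ (clB _ _ (fP z) (clZ (-1) _ (fP u)))).
  rewrite /= !scaleN1r => /(_ Wu).
  by rewrite normrZ normfV (gtr0_norm e0) ler_pdivrMl// mulr1.
have fd : (f : T -> R[i]^o) \in dual_pred by apply/asboolP.
exists (Dual fd) => x y; apply: uniq (fP _) => /=; apply: subset_closure.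
apply/lin_hull_family; exists 1%N, (fun=> 1), (fun=> (x, y)).
by rewrite big_ord1 scale1r.
Qed.

End TensorExtension.

(** * Adjoints and orthogonal projections of complex matrices *)

Section OrthogonalProjections.
Context {R : rcfType}.
Local Notation C := R[i].

Definition adjmx m n (A : 'M[C]_(m, n)) : 'M[C]_(n, m) := (map_mx Num.conj A)^T.

Lemma adjmxK m n : cancel (@adjmx m n) (@adjmx n m).
Proof. by move=> A; apply/matrixP => i j; rewrite !mxE conjCK. Qed.

Lemma adjmxM m n p (A : 'M[C]_(m, n)) (B : 'M[C]_(n, p)) :
  adjmx (A *m B) = adjmx B *m adjmx A.
Proof. by rewrite /adjmx map_mxM trmx_mul. Qed.

Lemma adjmxB m n (A B : 'M[C]_(m, n)) : adjmx (A - B) = adjmx A - adjmx B.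
Proof. by rewrite /adjmx map_mxB raddfB. Qed.

Lemma adjmx1 n : adjmx (1%:M : 'M[C]_n) = 1%:M.
Proof. by rewrite /adjmx map_mx1 trmx1. Qed.

Lemma adjmx_mul_eq0 m n (A : 'M[C]_(m, n)) : adjmx A *m A = 0 -> A = 0.
Proof.
move=> AA; apply/matrixP => i j; rewrite mxE.
have /matrixP/(_ j j) := AA; rewrite !mxE => /eqP.
rewrite psumr_eq0 => [/allP/(_ i)|k _].
  rewrite mem_index_enum => /(_ isT); rewrite !mxE mulrC -normCK.
  by rewrite expf_eq0/= normr_eq0 => /eqP.
by rewrite !mxE mulrC -normCK exprn_ge0.
Qed.

(* X Y is then the orthogonal projection onto the column space of X. *)
Lemma ex_adj_inverse m n (X : 'M[C]_(m, n)) : exists Y : 'M[C]_(n, m),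
  X *m Y *m X = X /\ adjmx (X *m Y) = X *m Y.
Proof.
(* As in the normal equations of least squares, [Y] is a generalized inverse of [adjmx X *m X] times
   [adjmx X]. *)
have [G GP] : exists G, adjmx X *m X *m (G *m adjmx X *m X) = adjmx X *m X.
  exists (pinvmx (adjmx X *m X)).
  by rewrite -[RHS](mulmxKpV (submx_refl _)) !mulmxA.
have XGX : X *m (G *m adjmx X) *m X = X.
  rewrite -mulmxA; apply/subr0_eq/adjmx_mul_eq0.
  set S := G *m _ *m _ in GP *.
  rewrite -[Z in _ - Z]mulmx1 -mulmxBr adjmxM -mulmxA.
  by rewrite [adjmx X *m _]mulmxA mulmxBr mulmx1 GP subrr mulmx0.
exists (G *m adjmx X); split=> //; set q := X *m _ in XGX *.
(* The left side is self-adjoint, hence so is [q]. *)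
have q2 : q *m adjmx q = adjmx q.
  have -> : adjmx q = X *m (adjmx G *m adjmx X).
    by rewrite /q !adjmxM adjmxK mulmxA.
  by rewrite mulmxA XGX.
by have := congr1 (@adjmx _ _) q2; rewrite adjmxM !adjmxK q2.
Qed.

End OrthogonalProjections.

(** * Finite sums in C*-algebras *)

Section CStarSums.
Context {R : realType} {A : cstarType R}.
Implicit Types (a b x : A) (c : R[i]).

Lemma cmulDl a b x : (a + b) ** x = a ** x + b ** x.
Proof. by have := cmul_linearl 1 a b x; rewrite !scale1r. Qed.

Lemma cmulDr a b x : x ** (a + b) = x ** a + x ** b.
Proof. by have := cmul_linearr 1 a b x; rewrite !scale1r. Qed.

Lemma cmul0l x : 0 ** x = 0 :> A.
Proof. by apply: (addIr (0 ** x)); rewrite -cmulDl !add0r. Qed.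

Lemma cmul0r x : x ** 0 = 0 :> A.
Proof. by apply: (addIr (x ** 0)); rewrite -cmulDr !add0r. Qed.

Lemma cmulZr c a x : x ** (c *: a) = c *: (x ** a).
Proof. by have := cmul_linearr c a 0 x; rewrite addr0 cmul0r addr0. Qed.

Lemma cmul_suml n (f : 'I_n -> A) x : (\sum_i f i) ** x = \sum_i f i ** x.
Proof.
by elim/big_ind2 : _ => [|_ u _ v <- <-|//]; [exact: cmul0l|exact: cmulDl].
Qed.

Lemma cmul_sumr n (f : 'I_n -> A) x : x ** (\sum_i f i) = \sum_i x ** f i.
Proof.
by elim/big_ind2 : _ => [|_ u _ v <- <-|//]; [exact: cmul0r|exact: cmulDr].
Qed.

Lemma star_sum n (f : 'I_n -> A) : star (\sum_i f i) = \sum_i star (f i).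
Proof.
have starD a b : star (a + b) = star a + star b.
  by have := star_antilinear 1 a b; rewrite rmorph1 !scale1r.
elim/big_ind2 : _ => [|_ u _ v <- <-|//]; last exact: starD.
by apply: (addIr (star 0)); rewrite -starD !add0r.
Qed.

End CStarSums.

Lemma linear_fun_sum {K : numFieldType} {V W : lmodType K} (f : V -> W) :
  linear f -> forall n (x : 'I_n -> V), f (\sum_i x i) = \sum_i f (x i).
Proof.
move=> lf n x; pose g : {linear V -> W} := HB.pack f (GRing.isLinear.Build _ _ _ _ _ lf).
by rewrite -[LHS]/(g _) linear_sum.
Qed.

(** * Schur's lemma and intertwiners from Haar averages *)

Section Schur.
Context {R : realType} {G : cqg R}.
Local Notation C := R[i].

Lemma lmulmxA m n p q (s : 'M[C]_(m, n)) (t : 'M[C]_(n, p)) (u : 'M[G]_(p, q)) :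
  lmulmx s (lmulmx t u) = lmulmx (s *m t) u.
Proof.
apply/matrixP => i j; rewrite !mxE.
under eq_bigr do rewrite mxE scaler_sumr.
rewrite exchange_big; apply: eq_bigr => k _.
by rewrite mxE scaler_suml; apply: eq_bigr => l _; rewrite scalerA.
Qed.

Lemma rmulmxA m n p q (u : 'M[G]_(m, n)) (s : 'M[C]_(n, p)) (t : 'M[C]_(p, q)) :
  rmulmx (rmulmx u s) t = rmulmx u (s *m t).
Proof.
apply/matrixP => i j; rewrite !mxE.
under eq_bigr do rewrite mxE scaler_sumr.
rewrite exchange_big; apply: eq_bigr => k _.
by rewrite mxE scaler_suml; apply: eq_bigr => l _; rewrite scalerA mulrC.
Qed.

Lemma lrmulmx m n p q (s : 'M[C]_(m, n)) (u : 'M[G]_(n, p)) (t : 'M[C]_(p, q)) :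
  lmulmx s (rmulmx u t) = rmulmx (lmulmx s u) t.
Proof.
apply/matrixP => i j; rewrite !mxE.
under eq_bigr do rewrite mxE scaler_sumr.
rewrite exchange_big; apply: eq_bigr => k _.
by rewrite mxE scaler_sumr; apply: eq_bigr => l _; rewrite !scalerA mulrC.
Qed.

(* X Y and 1 - Z X are the orthogonal projections onto the range and the kernel
   of X; both subspaces are invariant, so X is zero or bijective. *)
Lemma schur (u v : finrep G) (X : 'M[C]_(fdim v, fdim u)) :
  irreducible_rep u -> irreducible_rep v -> rmulmx v X = lmulmx X u ->
  X = 0 \/ equivalent_rep v u.
Proof.
move=> [_ u_irr] [_ v_irr] vX.
have [Y [XYX Yadj]] := ex_adj_inverse X.
(* Taking adjoints turns this into an inverse of [X] whose product with [X] on the other side is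
   self-adjoint. *)
have [Z [XZX Zadj]] := ex_adj_inverse (adjmx X).
have {}XZX : X *m adjmx Z *m X = X.
  by rewrite -[RHS]adjmxK -XZX !adjmxM !adjmxK mulmxA.
have {}Zadj : adjmx (adjmx Z *m X) = adjmx Z *m X.
  by rewrite adjmxM adjmxK -Zadj adjmxM adjmxK.
move: (adjmx Z) XZX Zadj => {}Z XZX Zadj.
have [XY0|XY1] : X *m Y = 0 \/ X *m Y = 1%:M.
- apply: v_irr => //; first by rewrite mulmxA XYX.
  by rewrite -[in LHS]rmulmxA vX -lrmulmx lmulmxA XYX lrmulmx -vX rmulmxA.
- by left; rewrite -XYX XY0 mul0mx.
pose p := 1%:M - Z *m X.
have Xp : X *m p = 0 by rewrite mulmxBr mulmx1 mulmxA XZX subrr.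
have [p0|p1] : p = 0 \/ p = 1%:M.
- apply: u_irr.
  + by rewrite {1}/p mulmxBl mul1mx -mulmxA Xp mulmx0 subr0.
  + by rewrite -/(adjmx p) adjmxB adjmx1 Zadj.
  (* Invariance of the kernel: [X u p = v X p = 0]. *)
  + have ZXup : lmulmx (Z *m X) (rmulmx u p) = 0.
      rewrite -lmulmxA [lmulmx X _]lrmulmx -vX rmulmxA Xp.
      apply/matrixP => i j; rewrite !mxE big1// => k _.
      by rewrite mxE big1 ?scaler0// => l _; rewrite mxE scale0r.
    rewrite -[RHS]subr0 -ZXup; move: (rmulmx u p) => w.
    apply/matrixP => i j; rewrite !mxE.
    have -> : w i j = \sum_k (1%:M : 'M[C]__) i k *: w k j.
      rewrite (bigD1 i)//= mxE eqxx scale1r big1 ?addr0// => k ki.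
      by rewrite mxE eq_sym (negbTE ki) scale0r.
    rewrite -sumrB; apply: eq_bigr => k _.
    by rewrite -scalerBl !mxE.
- right; have ZX1 : Z *m X = 1%:M by apply/esym/subr0_eq.
  exists X, Z; split=> //.
  by rewrite -[LHS]mulmx1 -XY1 mulmxA -[X *m Z *m X]mulmxA ZX1 mulmx1.
left; rewrite -XZX -mulmxA (_ : Z *m X = 0) ?mulmx0//.
by apply: oppr_inj; rewrite oppr0; apply: (addrI 1%:M); rewrite addr0.
Qed.

(* Slicing Delta (star (v k p) ** u l q) by h (x) id gives v^* X u = X. *)
Lemma haar_intertwiner (h : G -> C^o) (u v : finrep G) k l : haar_state h ->
  unitary_rep u -> unitary_rep v ->
  let X := \matrix_(p, q) (h (star (v k p) ** u l q) : C) in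
  rmulmx v X = lmulmx X u.
Proof.
move=> [_ _ _ [f [lf _ ft fD]] _] [uD _ _] [vD vvs _] X.
have [lD DM _ DS] := cqg_Delta G.
have tP := cqg_tens G.
have avg p q : \sum_s \sum_t X s t *: (star (v s p) ** u t q) = X p q *: (cone : G).
  rewrite [X p q]mxE -fD DM DS uD vD star_sum cmul_suml (linear_fun_sum lf).
  apply: eq_bigr => s _; rewrite cmul_sumr (linear_fun_sum lf).
  by apply: eq_bigr => t _; rewrite (mt_star tP) (mt_mul tP) ft mxE.
(* Multiplying the averaged identity by [v] on the left leaves, by unitarity, only the terms with
   [s = r]. *)
apply/matrixP => r q; rewrite !mxE.
transitivity (\sum_p v r p ** (X p q *: (cone : G))).
  by apply: eq_bigr => p _; rewrite cmulZr cmul1r.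
under eq_bigr do rewrite -avg cmul_sumr.
rewrite exchange_big/= (bigD1 r)//= [X in _ + X]big1 ?addr0 => [|s sr].
  under eq_bigr do rewrite cmul_sumr.
  rewrite exchange_big; apply: eq_bigr => t _ /=.
  under eq_bigr do rewrite cmulZr cmulA.
  by rewrite -scaler_sumr -cmul_suml vvs eqxx scale1r cmul1l.
under eq_bigr do rewrite cmul_sumr.
rewrite exchange_big big1// => t _ /=.
under eq_bigr do rewrite cmulZr cmulA.
by rewrite -scaler_sumr -cmul_suml vvs eq_sym (negbTE sr) scale0r cmul0l scaler0.
Qed.

End Schur.

(** * Orthogonality of coefficients with different eigenvalues *)

Section Orthogonality.
Context {R : realType} {G : cqg R} {L2 : hilbertType R} {I : choiceType}.

(** The inner product is an entry of the Haar intertwiner. Different eigenvalues belong to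
    inequivalent representations, so Schur's lemma makes that intertwiner zero. *)
Lemma coef_orth (h : G -> R[i]^o) (Lam : G -> L2) (pi : I -> finrep G)
    (lam : I -> R) (j k : coef_index pi) :
  haar_state h -> is_gns h Lam -> irr_system pi ->
  lam (tag j) != lam (tag k) ->
  dot (eigenvector Lam j) (eigenvector Lam k) = 0.
Proof.
move=> h_haar [_ Lam_dot _] [pi_u pi_irr pi_inj _] jk.
rewrite Lam_dot /coef.
set u := pi (tag j); set v := pi (tag k).
have := haar_intertwiner (tagged k).1 (tagged j).1 h_haar (pi_u (tag j)) (pi_u (tag k)).
move=> /(schur (pi_irr _) (pi_irr _))[|/pi_inj kj].
  by move=> /matrixP/(_ (tagged k).2 (tagged j).2); rewrite !mxE.
by move: jk; rewrite kj eqxx.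
Qed.

End Orthogonality.

Theorem theorem6p11 (R : realType) (G : cqg R)
  (h : G -> R[i]^o) (h_haar : haar_state h)
  (L2 : hilbertType R) (Lam : G -> L2) (Lam_gns : is_gns h Lam)
  (I : choiceType) (pi : I -> finrep G) (pi_irr : irr_system pi)
  (lam : I -> R) (lam_neq0 : forall i, lam i != 0)
  (triple : spectral_triple Lam pi lam)
  (summable : summable_triple pi lam)
  (T : tvsType R[i]) (tensor : Cinfty Lam pi lam -> Cinfty Lam pi lam -> T)
  (tensorP : completed_tensor tensor)
  (A : {linear Cinfty Lam pi lam -> dual (Cinfty Lam pi lam)})
  (A_continuous : continuous A) :
  exists KA : dual T, forall phi psi : Cinfty Lam pi lam,
    A phi psi = KA (tensor phi psi).
Proof.
have orth (j k : coef_index pi) : Defs.eigenvalue lam j != Defs.eigenvalue lam k ->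
    dot (eigenvector Lam j) (eigenvector Lam k) = 0.
  exact: coef_orth h_haar Lam_gns pi_irr.
have [U U0 AU] := strong_continuous_bilinear (E := Cinfty Lam pi lam)
  (@smooth_base_nbhs _ _ _ _ _) (smooth_base_subset orth) A_continuous.
apply: (completed_tensor_extend tensorP _ _ U0 U0 AU).
- by move=> psi c u v; rewrite linearP.
- move=> phi; have : dual_fun (A phi) \in dual_pred by case: (A phi).
  by move=> /asboolP[].
Qed.
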